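(* For every positive integer $e$ and every positive divisor $d$ of $e$, the star $S_{e+1}$ admits a $d$-graceful $\alpha$-labeling.
   Context: The star $S_{e+1}$ is the complete bipartite graph with one part consisting of a single vertex (the center) and the other part of $e$ vertices. For a graph $\Gamma$ of size $e$ and a divisor $d$ of $e$ with $e=d\cdot m$, a $d$-graceful labeling of $\Gamma$ is an injective function $f:V(\Gamma)\to\{0,1,\ldots,d(m+1)-1\}$ such that $\{|f(x)-f(y)| : [x,y]\in E(\Gamma)\}=\{1,2,\ldots,d(m+1)-1\}\setminus\{m+1,2(m+1),\ldots,(d-1)(m+1)\}$. If $\Gamma$ is bipartite with parts $X,Y$, a $d$-graceful $\alpha$-labeling is a $d$-graceful labeling $f$ such that $\max f(X)<\min f(Y)$ for a suitable ordering of the two parts. *)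

(* Defs.v *)
From mathcomp Require Import all_boot all_order all_algebra.

Set Implicit Arguments.
Unset Strict Implicit.
Unset Printing Implicit Defensive.

Record sgraph := SGraph {
  vertex :> finType;
  adj : rel vertex;
  adj_sym : symmetric adj;
  adj_irrefl : irreflexive adj }.

Definition edges (G : sgraph) : {set {set G}} :=
  [set [set p.1; p.2] | p : G * G & adj p.1 p.2].

Definition graph_size (G : sgraph) : nat := #|edges G|.

Definition bipartition (G : sgraph) (X Y : {set G}) : Prop :=
  [/\ X :|: Y = [set: G], [disjoint X & Y]
    & forall x y : G, adj x y ->
        (x \in X) && (y \in Y) || (x \in Y) && (y \in X)].

Definition cb_adj (A B : finType) : rel (A + B) := fun u v =>
  match u, v with
  | inl _, inr _ | inr _, inl _ => true
  | _, _ => false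
  end.

Lemma cb_adj_sym (A B : finType) : symmetric (@cb_adj A B).
Proof. by case=> ? []. Qed.

Lemma cb_adj_irrefl (A B : finType) : irreflexive (@cb_adj A B).
Proof. by case. Qed.

Definition complete_bipartite (A B : finType) : sgraph :=
  SGraph (@cb_adj_sym A B) (@cb_adj_irrefl A B).

Definition cb_left (A B : finType) : {set complete_bipartite A B} :=
  [set inl a | a : A].
Definition cb_right (A B : finType) : {set complete_bipartite A B} :=
  [set inr b | b : B].

(* [star e] is the star with e edges, hence e + 1 vertices (S_{e+1}). *)
Definition star (e : nat) : sgraph := complete_bipartite 'I_1 'I_e.
Definition star_center (e : nat) : {set star e} := cb_left 'I_1 'I_e.
Definition star_leaves (e : nat) : {set star e} := cb_right 'I_1 'I_e.

Definition d_graceful_labeling (G : sgraph) (d : nat) (f : G -> nat) : Prop :=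
  let m := graph_size G %/ d in
  [/\ 0 < d, d %| graph_size G, injective f,
      (forall x, f x <= d * m.+1 - 1)
    & forall k : nat,
        (exists x y : G, adj x y /\ `|f x - f y|%N = k) <->
        (1 <= k <= d * m.+1 - 1 /\
         ~ (exists i, 1 <= i <= d - 1 /\ k = i * m.+1))].

(* Both parts are finite sets of naturals, so max f(X) < min f(Y) is stated
   pairwise; the disjunction is the choice of an ordering of the two parts. *)
Definition d_graceful_alpha_labeling (G : sgraph) (X Y : {set G}) (d : nat)
    (f : G -> nat) : Prop :=
  [/\ bipartition X Y, d_graceful_labeling d f
    & (forall x y, x \in X -> y \in Y -> f x < f y) \/
      (forall x y, x \in X -> y \in Y -> f y < f x)].

(* Main.v *)
Require Import Defs.
From mathcomp Require Import all_boot all_order all_algebra.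
From mathcomp Require Import zify.

(** Label the center [0]. The edge differences are then the leaf labels, so it
    suffices to enumerate increasingly the positive integers below [d (m+1)]
    that are not multiples of [m+1]: the leaf [j = q m + r] with [r < m] gets
    [q (m+1) + r + 1 = j + j %/ m + 1]. *)

(** Pairs in [A * B] correspond bijectively to edges through [edge]; the two orientations of an
    adjacent pair give the same set. *)
Lemma graph_size_complete_bipartite (A B : finType) :
  graph_size (complete_bipartite A B) = #|A| * #|B|.
Proof.
pose G := complete_bipartite A B.
pose edge (p : A * B) : {set G} := [set (inl p.1 : G); (inr p.2 : G)].
have edge_inj : injective edge.
  move=> [a b] [a' b'] /setP eq_edge.
  have := eq_edge (inl a); have := eq_edge (inr b).
  rewrite !inE !eqxx /= => /esym/eqP[->] /esym.
  by rewrite orbF => /eqP[->].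
rewrite /graph_size -card_prod -(card_imset predT edge_inj).
apply: eq_card => E; apply/imsetP/imsetP.
- case=> -[[a|b] [a'|b']]; rewrite inE //= => _ ->.
    by exists (a, b').
  by exists (a', b) => //; rewrite setUC.
- by case=> -[a b] _ ->; exists (inl a, inr b); rewrite ?inE.
Qed.

Lemma bipartition_complete_bipartite (A B : finType) :
  bipartition (cb_left A B) (cb_right A B).
Proof.
have inl_left a : inl a \in cb_left A B by apply: imset_f.
have inr_right b : inr b \in cb_right A B by apply: imset_f.
split.
- by apply/setP => -[a|b]; rewrite !inE ?inl_left ?inr_right ?orbT.
- rewrite -setI_eq0; apply/eqP/setP => x; rewrite !inE; apply/negbTE/negP.
  by case/andP => /imsetP[a _ ->] /imsetP[b].
- by case=> [a|b] [a'|b'] //= _; rewrite inl_left inr_right ?orbT.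
Qed.

Definition star_label (m e : nat) (v : star e) : nat :=
  if v is inr j then (j + j %/ m).+1 else 0.

(** Since [j %/ m] is nondecreasing in [j], the sum [j + j %/ m] is strictly increasing; the
    successor keeps leaves away from the center's 0. *)
Lemma star_label_inj (m e : nat) : injective (@star_label m e).
Proof.
case=> [a|i] [b|j] //=; first by rewrite (ord1 a) (ord1 b).
case=> eq_ij; congr inr; apply: val_inj => /=.
have [ij|ji|//] := ltngtP i j.
- by have := leq_div2r m (ltnW ij); lia.
- by have := leq_div2r m (ltnW ji); lia.
Qed.

Lemma skip_multiples (m d k : nat) : 0 < m -> 0 < d ->
  (exists2 j, j < d * m & (j + j %/ m).+1 = k) <->
  (1 <= k <= d * m.+1 - 1 /\
   ~ (exists i, 1 <= i <= d - 1 /\ k = i * m.+1)).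
Proof.
move=> m0 d0; split.
- case=> j jdm <-.
  have qd : j %/ m < d by rewrite ltn_divLR.
  have rm := ltn_pmod j m0; have jE := divn_eq j m.
  split; first by nia.
  (* With [q = j %/ m], the value lies strictly between the consecutive multiples [q * m.+1] and
     [q.+1 * m.+1]. *)
  by case=> i [_ eq_i]; have [|] := leqP i (j %/ m); nia.
- case=> /andP[k1 kle] nmul.
  have kE := divn_eq k m.+1; have rm := ltn_pmod k (ltn0Sn m).
  have qd : k %/ m.+1 < d by rewrite ltn_divLR //; lia.
  (* A zero remainder would make [k] an excluded multiple: its quotient is positive because [k] is,
     and below [d] by [qd]. *)
  have r0 : 0 < k %% m.+1.
    rewrite lt0n; apply/eqP => r0; apply: nmul; exists (k %/ m.+1).
    by split; nia.
  (* Each block of [m.+1] integers loses its multiple, so the quotient is kept and the remainder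
     drops by one. *)
  exists (k %/ m.+1 * m + (k %% m.+1).-1); first by nia.
  rewrite divnMDl // (@divn_small _.-1) ?addn0; last by rewrite -ltnS prednK.
  by rewrite addnAC -addnS prednK // [RHS]kE mulnSr.
Qed.

Theorem theorem3p3 (e d : nat) (he : 0 < e) (hd : 0 < d) (hde : d %| e) :
  exists f : star e -> nat,
    d_graceful_alpha_labeling (star_center e) (star_leaves e) d f.
Proof.
have eE : d * (e %/ d) = e by rewrite mulnC divnK.
have m0 : 0 < e %/ d by rewrite divn_gt0 // dvdn_leq.
exists (@star_label (e %/ d) e); split.
- exact: bipartition_complete_bipartite.
- rewrite /d_graceful_labeling graph_size_complete_bipartite !card_ord mul1n.
  have labels k := skip_multiples (e %/ d) d k m0 hd.
  split=> //; first exact: star_label_inj.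
    case=> [//|j] /=.
    (* The upper bound on leaf labels is part of the forward direction of [labels]. *)
    have /labels[/andP[_ //]] : exists2 i, i < d * (e %/ d) &
        (i + i %/ (e %/ d)).+1 = (j + j %/ (e %/ d)).+1.
    by exists (j : nat); rewrite ?eE.
  move=> k; rewrite -labels eE; split.
  (* Every edge has the center, labeled 0, at one end, so its difference is the label of its
     leaf. *)
  + case=> -[a|i] [[b|j]] [] //= _ <-.
      by exists (j : nat); rewrite ?ltn_ord ?subn0.
    by exists (i : nat); rewrite ?ltn_ord ?addn0.
  + case=> j je <-; exists (inl ord0), (inr (Ordinal je)).
    by rewrite /= subn0.
- by left=> x y /imsetP[a _ ->] /imsetP[j _ ->].
Qed.
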